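(* For every integer $r\ge 3$ there is a constant $c_r$ such that for every graph $G$ with $m$ edges and no isolated vertices, \[ r(K_r,G)\le c_r\, m^{\frac{r-1}{2}}. \]
   Context: For graphs $H$ and $G$, the Ramsey number $r(H,G)$ is the least positive integer $N$ such that every red/blue coloring of the edges of the complete graph $K_N$ contains a red copy of $H$ or a blue copy of $G$. $K_r$ denotes the complete graph on $r$ vertices. *)

(* Defs.v *)
From HB Require Import structures.
From mathcomp Require Import all_boot all_order all_algebra.
From mathcomp Require Import all_reals exp.

Set Implicit Arguments.
Unset Strict Implicit.
Unset Printing Implicit Defensive.

Record sgraph := SGraph {
  vertex :> finType;
  adj : rel vertex;
  adj_sym : symmetric adj;
  adj_irrefl : irreflexive adj
}.

Definition edges (G : sgraph) : {set {set G}} :=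
  [set E : {set G} | [exists x, exists y, adj x y && (E == [set x; y])]].

Definition no_isolated (G : sgraph) : Prop :=
  forall x : G, exists y : G, adj x y.

Lemma neq_sym (T : eqType) : symmetric (fun x y : T => x != y).
Proof. by move=> x y; rewrite eq_sym. Qed.

Lemma neq_irrefl (T : eqType) : irreflexive (fun x y : T => x != y).
Proof. by move=> x; rewrite eqxx. Qed.

Definition complete_graph (n : nat) : sgraph :=
  SGraph (@neq_sym 'I_n) (@neq_irrefl 'I_n).

(* An edge of K_N is a set [set i; j] with i != j; the values of a coloring on
   the other subsets of 'I_N are never used. Red is true, blue is false. *)
Definition coloring (N : nat) := {ffun {set 'I_N} -> bool}.

(* A copy is a not necessarily induced subgraph. *)
Definition mono_copy (N : nat) (c : coloring N) (b : bool) (G : sgraph) : bool :=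
  [exists f : {ffun G -> 'I_N},
    injectiveb f &&
    [forall x, forall y, adj x y ==> (c [set f x; f y] == b)]].

Definition arrows (N : nat) (H G : sgraph) : bool :=
  [forall c : coloring N, mono_copy c true H || mono_copy c false G].

Definition mono_clique (T : finType) (c : {set T} -> bool) (b : bool)
    (B : {set T}) : Prop :=
  forall x y, x \in B -> y \in B -> x != y -> c [set x; y] = b.

Lemma mono_clique_add (T : finType) (c : {set T} -> bool) (b : bool)
    (B : {set T}) (x : T) :
  mono_clique c b B -> (forall y, y \in B -> c [set x; y] = b) ->
  mono_clique c b (x |: B).
Proof.
move=> cB cx y z; rewrite !inE => /orP[/eqP->|yB] /orP[/eqP->|zB].
- by rewrite eqxx.
- by move=> _; apply: cx.
- by move=> _; rewrite setUC; apply: cx.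
- exact: cB.
Qed.

Lemma ramsey_cliques (s t : nat) : exists N, forall (T : finType)
    (c : {set T} -> bool) (A : {set T}), N <= #|A| ->
  exists2 B : {set T}, B \subset A &
    (#|B| = s /\ mono_clique c true B) \/ (#|B| = t /\ mono_clique c false B).
Proof.
elim: s t => [|s IHs] t.
  exists 0 => T c A _; exists set0; first exact: sub0set.
  by left; rewrite cards0; split=> // x y; rewrite inE.
elim: t => [|t [N2 IHt]].
  exists 0 => T c A _; exists set0; first exact: sub0set.
  by right; rewrite cards0; split=> // x y; rewrite inE.
have [N1 {}IHs] := IHs t.+1; exists (N1 + N2).+1 => T c A leA.
have /card_gt0P[x xA] : 0 < #|A| by apply: leq_ltn_trans leA.
pose P := [set y | c [set x; y]].
have subA (D : {set T}) : D \subset A :\ x -> x |: D \subset A.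
  by move=> sD; rewrite subUset sub1set xA (subset_trans sD) ?subsetDl.
have cardU (D : {set T}) : D \subset A :\ x -> #|x |: D| = #|D|.+1.
  move=> sD; rewrite cardsU1; case: (boolP (x \in D)) => //= /(subsetP sD).
  by rewrite !inE eqxx.
have : N1 + N2 <= #|(A :\ x) :&: P| + #|(A :\ x) :\: P|.
  by rewrite cardsID -ltnS (leq_trans leA) // (cardsD1 x A) xA.
case: (leqP N1 #|(A :\ x) :&: P|) => [le1 _|lt1 leN].
  have [B sB HB] := IHs T c _ le1.
  have sBx : B \subset A :\ x by apply: subset_trans sB (subsetIl _ _).
  case: HB => [[cB mB]|[cB mB]].
    exists (x |: B); first exact: subA.
    left; split; first by rewrite cardU // cB.
    apply: mono_clique_add => // y /(subsetP sB).
    by rewrite !inE => /andP[_ ->].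
  exists B; first exact: subset_trans sBx (subsetDl _ _).
  by right.
have le2 : N2 <= #|(A :\ x) :\: P|.
  by rewrite -(leq_add2l N1) (leq_trans leN) // leq_add2r ltnW.
have [B sB HB] := IHt T c _ le2.
have sBx : B \subset A :\ x by apply: subset_trans sB (subsetDl _ _).
case: HB => [[cB mB]|[cB mB]].
  exists B; first exact: subset_trans sBx (subsetDl _ _).
  by left.
exists (x |: B); first exact: subA.
right; split; first by rewrite cardU // cB.
apply: mono_clique_add => // y /(subsetP sB).
by rewrite !inE => /andP[/negbTE-> _].
Qed.

Lemma mono_clique_copy (N : nat) (c : coloring N) (b : bool) (G : sgraph)
    (B : {set 'I_N}) :
  #|B| = #|G| -> mono_clique c b B -> mono_copy c b G.
Proof.
move=> cB mB; apply/existsP.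
pose f (x : G) := enum_val (cast_ord (esym cB) (enum_rank x)).
have finj : injective f.
  by move=> x y /enum_val_inj/cast_ord_inj/enum_rank_inj.
exists (finfun f); apply/andP; split.
  by apply/injectiveP => x y; rewrite !ffunE => /finj.
apply/'forall_forallP => x y; apply/implyP => xy; rewrite !ffunE; apply/eqP.
apply: mB; try exact: enum_valP.
by apply: contraTneq xy => /finj->; rewrite adj_irrefl.
Qed.

Lemma ramsey_exists (H G : sgraph) : exists N, (0 < N) && arrows N H G.
Proof.
have [N HN] := ramsey_cliques #|H| #|G|; exists N.+1; apply/forallP => c.
have leN : N <= #|[set: 'I_N.+1]| by rewrite cardsT card_ord.
have [B _ [] [cB mB]] := HN _ c _ leN.
  by rewrite (mono_clique_copy cB mB).
by rewrite (mono_clique_copy cB mB) orbT.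
Qed.

Definition ramsey_number (H G : sgraph) : nat := ex_minn (ramsey_exists H G).

(* Main.v *)
Require Import Defs.
From mathcomp Require Import all_boot all_order all_algebra.
From mathcomp Require Import all_reals exp.
From mathcomp Require Import zify.

Set Implicit Arguments.
Unset Strict Implicit.
Unset Printing Implicit Defensive.
Import Order.TTheory GRing.Theory Num.Theory.

(** Let G have n vertices and m edges, let S be a set of vertices of the host,
    and let D be the maximum red degree in S.  A greedy embedding of G into the
    blue graph on S succeeds as soon as, at each step, D times the number of
    neighbours already embedded, plus n, is at most #|S|.

    If S has no red triangle, a red neighbourhood of size D is a blue clique
    and hosts all vertices of degree greater than 2m / D, of which there are at
    most D; each remaining vertex has at most 2m / D neighbours, so
    #|S| >= n + 2m suffices.  If S has no larger red clique, either some red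
    neighbourhood is large enough to apply induction inside it, or D is at most
    the bound for smaller cliques.  In the latter case, the vertices of degree
    greater than sqrt (2m), at most sqrt (2m) in number, are embedded first,
    so that at most sqrt (2m) neighbours precede any vertex. *)

Section Degrees.
Variable G : sgraph.
Implicit Types (A B : {set G}) (x y : G).

Definition degree_in A x := #|[set y in A | adj x y]|.

Definition degree x := degree_in [set: G] x.

Lemma degree_inS A B x : A \subset B -> degree_in A x <= degree_in B x.
Proof.
move=> sAB; apply/subset_leq_card/subsetP => y.
by rewrite !inE => /andP[/(subsetP sAB)-> ->].
Qed.

Lemma degree_in_leq_card A x : degree_in A x <= #|A|.
Proof. by apply/subset_leq_card/subsetP => y; rewrite inE => /andP[]. Qed.

Lemma card_edge (E : {set G}) : E \in edges G -> #|E| = 2.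
Proof.
rewrite inE => /existsP[x /existsP[y /andP[xy /eqP->]]].
by rewrite cards2; case: eqP xy => // ->; rewrite adj_irrefl.
Qed.

Lemma card_incident_edges x : #|[set E in edges G | x \in E]| = degree x.
Proof.
rewrite /degree /degree_in -(card_in_imset (f := fun y => [set x; y])).
  apply: eq_card => E; rewrite !inE; apply/andP/imsetP => [[]|[y]].
    case/existsP=> a /existsP[b /andP[ab /eqP->]]; rewrite !inE.
    case/orP=> /eqP->; first by exists b; rewrite ?inE.
    by exists a; rewrite ?inE 1?adj_sym // setUC.
  rewrite !inE /= => xy ->; split; last by rewrite !inE eqxx.
  by apply/existsP; exists x; apply/existsP; exists y; rewrite xy eqxx.
move=> y z; rewrite !inE /= => xy _ /setP /(_ y).
rewrite !inE eqxx orbT => /esym/orP[/eqP yx|/eqP//].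
by rewrite yx adj_irrefl in xy.
Qed.

Lemma handshake : \sum_x degree x = 2 * #|edges G|.
Proof.
transitivity (\sum_x \sum_(E in edges G | x \in E) 1).
  by apply: eq_bigr => x _; rewrite -card_incident_edges -sum1dep_card.
rewrite (exchange_big_dep (mem (edges G))) => [|x E _ /andP[]//] /=.
rewrite mulnC -sum_nat_const; apply: eq_bigr => E eE.
by rewrite -(card_edge eE) -sum1_card; apply: eq_bigl => x; rewrite eE.
Qed.

Lemma no_isolated_card_leq : no_isolated G -> #|G| <= 2 * #|edges G|.
Proof.
move=> noiso; rewrite -handshake -sum1_card leq_sum // => x _.
by have [y xy] := noiso x; apply/card_gt0P; exists y; rewrite !inE.
Qed.

Definition high_degree (t : nat) : {set G} :=
  [set x | 2 * #|edges G| < degree x * t].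

Lemma card_high_degree_leq t : #|high_degree t| <= t.
Proof.
set H := high_degree t; set m2 := 2 * #|edges G|.
have degH : #|H| * m2.+1 <= (\sum_(x in H) degree x) * t.
  by rewrite -sum_nat_const big_distrl leq_sum // => x; rewrite inE.
have : \sum_(x in H) degree x <= m2.
  by rewrite /m2 -handshake [leqRHS](bigID (mem H)) leq_addr.
rewrite leqNgt; nia.
Qed.

End Degrees.

Lemma card_bigcup_leq (I T : finType) (P : pred I) (F : I -> {set T}) :
  #|\bigcup_(i | P i) F i| <= \sum_(i | P i) #|F i|.
Proof.
elim/big_rec2: _ => [|i n B _ leB]; first by rewrite cards0.
by rewrite (leq_trans (leq_card_setU _ _)) // leq_add2l.
Qed.

Section RedCliques.
Variables (T : finType) (c : {set T} -> bool).
Implicit Types (S B : {set T}) (x : T).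

Definition red_nbhd S x : {set T} := [set y in S | (y != x) && c [set x; y]].

Definition red_degree_le S (D : nat) : Prop :=
  {in S, forall x, #|red_nbhd S x| <= D}.

Definition red_clique_free (r : nat) S : Prop :=
  forall B, B \subset S -> mono_clique c true B -> #|B| != r.

Lemma red_nbhd_subset S x : red_nbhd S x \subset S.
Proof. by apply/subsetP => y; rewrite inE => /andP[]. Qed.

Lemma red_nbhd_clique_free r S x :
  x \in S -> red_clique_free r.+1 S -> red_clique_free r (red_nbhd S x).
Proof.
move=> xS free B sB Bred.
have xB : x \notin B by apply/negP => /(subsetP sB); rewrite !inE eqxx andbF.
have: #|x |: B| != r.+1.
  apply: free.
    by rewrite subUset sub1set xS (subset_trans sB) ?red_nbhd_subset.
  by apply: mono_clique_add => // y /(subsetP sB); rewrite !inE => /and3P[].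
by rewrite cardsU1 xB.
Qed.

Lemma red_clique_free1_set0 S : red_clique_free 1 S -> S = set0.
Proof.
move=> free; apply/eqP/set0Pn => -[x xS].
suff: #|[set x]| != 1 by rewrite cards1.
apply: free; first by rewrite sub1set.
by move=> y z /set1P-> /set1P->; rewrite eqxx.
Qed.

Lemma red_clique_free2_degree0 S : red_clique_free 2 S -> red_degree_le S 0.
Proof.
move=> free x xS; have freeN := red_nbhd_clique_free xS free.
by rewrite (red_clique_free1_set0 freeN) cards0.
Qed.

Lemma max_red_degree_attained S :
  0 < #|S| -> exists2 x, x \in S & red_degree_le S #|red_nbhd S x|.
Proof.
case/card_gt0P=> x0 x0S.
by case: (arg_maxnP (fun x => #|red_nbhd S x|) x0S) => x; exists x.
Qed.

End RedCliques.

Section BlueEmbeddings.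
Variables (T : finType) (c : {set T} -> bool) (G : sgraph).
Implicit Types (S : {set T}) (A B : {set G}) (f : G -> T).

Definition blue_embedding A S f : Prop :=
  [/\ {in A &, injective f}, {in A, forall x, f x \in S}
    & {in A &, forall x y, adj x y -> c [set f x; f y] = false}].

Lemma blue_embeddingS A S1 S2 f :
  S1 \subset S2 -> blue_embedding A S1 f -> blue_embedding A S2 f.
Proof. by move=> /subsetP sS [finj fS fblue]; split=> // x /fS /sS. Qed.

Definition blocked_hosts A S f (v : G) : {set T} :=
  f @: A :|: \bigcup_(u in A | adj v u) red_nbhd c S (f u).

Lemma card_blocked_hosts A S f v D :
    blue_embedding A S f -> red_degree_le c S D ->
  #|blocked_hosts A S f v| <= degree_in A v * D + #|A|.
Proof.
move=> [_ fS _] degS; rewrite addnC (leq_trans (leq_card_setU _ _)) //.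
rewrite leq_add ?leq_imset_card // (leq_trans (card_bigcup_leq _ _)) //.
rewrite /degree_in cardsE -sum_nat_const.
by apply: leq_sum => u /andP[uA _]; apply/degS/fS.
Qed.

Lemma blue_embedding_add A S f v w :
    blue_embedding A S f -> v \notin A -> w \in S :\: blocked_hosts A S f v ->
  blue_embedding (v |: A) S [eta f with v |-> w].
Proof.
move=> [finj fS fblue] vA /setDP[wS]; rewrite inE negb_or => /andP[wfA wnred].
have neqw u : u \in A -> f u != w.
  by move=> uA; apply: contraNneq wfA => <-; apply: imset_f.
have bluew u : u \in A -> adj v u -> c [set f u; w] = false.
  move=> uA vu; apply: contraNF wnred => red; apply/bigcupP.
  by exists u; rewrite ?uA // inE wS red eq_sym neqw.
have gA u : u \in A -> [eta f with v |-> w] u = f u.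
  by move=> uA /=; case: eqP uA vA => // -> ->.
have gv : [eta f with v |-> w] v = w by rewrite /= eqxx.
split=> [x y|x|x y].
- move=> /setU1P[->|xA] /setU1P[->|yA] //; rewrite ?gv ?gA //.
  + by move/esym/eqP; rewrite (negbTE (neqw _ yA)).
  + by move/eqP; rewrite (negbTE (neqw _ xA)).
  + exact: finj.
- by move=> /setU1P[->|xA]; rewrite ?gv ?gA ?fS.
move=> /setU1P[->|xA] /setU1P[->|yA]; rewrite ?gv ?gA //.
- by rewrite adj_irrefl.
- by rewrite setUC; apply: bluew.
- by rewrite adj_sym; apply: bluew.
- exact: fblue.
Qed.

Lemma greedy_extension A B S f D :
    A \subset B -> blue_embedding A S f -> red_degree_le c S D ->
    {in B :\: A, forall v, degree_in B v * D + #|B| <= #|S|} ->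
  exists g, blue_embedding B S g.
Proof.
move=> + + degS; have [n] := ubnP #|B :\: A|.
elim: n A f => // n IHn A f leBA sAB emb room.
have [sBA | /subsetPn[v vB vA]] := boolP (B \subset A).
  by exists f; have -> : B = A by apply/eqP; rewrite eqEsubset sBA.
have vBA : v \in B :\: A by rewrite inE vA.
have [w wfree] : exists w, w \in S :\: blocked_hosts A S f v.
  have ltAB : #|A| < #|B| by apply/proper_card/properP; split=> //; exists v.
  have ltS : #|blocked_hosts A S f v| < #|S|.
    apply: leq_ltn_trans (card_blocked_hosts v emb degS) _.
    apply: leq_trans (room v vBA).
    by rewrite -addnS leq_add // leq_mul2r degree_inS ?orbT.
  apply/set0Pn; rewrite setD_eq0; apply: contraTN ltS => /subset_leq_card.
  by rewrite -leqNgt.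
apply: IHn (blue_embedding_add emb vA wfree) _.
- by rewrite setUC -setDDl; move: leBA; rewrite (cardsD1 v (B :\: A)) vBA.
- by rewrite subUset sub1set vB.
- move=> u; rewrite !inE negb_or -andbA => /and3P[_ uA uB].
  by apply: room; rewrite inE uA.
Qed.

Lemma greedy_embedding (x0 : T) A S D :
    red_degree_le c S D ->
    {in A, forall v, degree_in A v * D + #|A| <= #|S|} ->
  exists f, blue_embedding A S f.
Proof.
move=> degS room.
have emb0 : blue_embedding set0 S (fun=> x0) by split=> [x|x|x]; rewrite inE.
by apply: (greedy_extension (sub0set A) emb0 degS); rewrite setD0.
Qed.

End BlueEmbeddings.

Section CliqueFreeHosts.
Variables (T : finType) (c : {set T} -> bool) (G : sgraph).
Hypothesis G_gt0 : 0 < #|G|.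
Implicit Type S : {set T}.

Lemma triangle_free_embedding S :
    #|G| + 2 * #|edges G| <= #|S| -> red_clique_free c 3 S ->
  exists f, blue_embedding c [set: G] S f.
Proof.
move=> leS free.
have [w wS degS] : exists2 w, w \in S & red_degree_le c S #|red_nbhd c S w|.
  by apply: max_red_degree_attained; lia.
set N := red_nbhd c S w in degS.
have [f embN] : exists f, blue_embedding c (high_degree G #|N|) N f.
  have degN := red_clique_free2_degree0 (red_nbhd_clique_free wS free).
  by apply: (greedy_embedding w degN) => v _; rewrite muln0 card_high_degree_leq.
have embS := blue_embeddingS (red_nbhd_subset c S w) embN.
apply: (greedy_extension (subsetT _) embS degS) => v.
by rewrite !inE andbT -leqNgt cardsT -/(degree v); lia.
Qed.

Lemma bounded_red_degree_embedding S D t :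
    0 < t -> 2 * #|edges G| <= t ^ 2 -> red_degree_le c S D ->
    t * D + #|G| <= #|S| ->
  exists f, blue_embedding c [set: G] S f.
Proof.
move=> t_gt0 tm degS leS; pose H := high_degree G t.
have [f embH] : exists f, blue_embedding c H S f.
  have /card_gt0P[x0 _] : 0 < #|S| by lia.
  apply: (greedy_embedding x0 degS) => v _.
  apply: leq_trans leS; rewrite leq_add ?max_card // leq_mul2r.
  by rewrite (leq_trans (degree_in_leq_card _ _)) ?card_high_degree_leq ?orbT.
apply: (greedy_extension (subsetT H) embH degS) => v.
rewrite !inE andbT -leqNgt cardsT -/(degree v) => low.
apply: leq_trans leS; rewrite leq_add2r leq_mul2r -(leq_pmul2r t_gt0) mulnn.
by rewrite (leq_trans low) ?orbT.
Qed.

Lemma clique_free_embedding t k S :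
    0 < t -> 2 * #|edges G| <= t ^ 2 ->
    (k.+1 * #|G| + 2 * #|edges G|) * t ^ k <= #|S| ->
    red_clique_free c k.+3 S ->
  exists f, blue_embedding c [set: G] S f.
Proof.
move=> t_gt0 tm; elim: k S => [|k IHk] S leS free.
  by apply: triangle_free_embedding free; rewrite muln1 mul1n in leS.
set D := (k.+1 * #|G| + 2 * #|edges G|) * t ^ k in IHk.
have [/exists_inP[x xS leN]|] := boolP [exists x in S, D <= #|red_nbhd c S x|].
  have [f embN] := IHk _ leN (red_nbhd_clique_free xS free).
  by exists f; apply: blue_embeddingS embN; apply: red_nbhd_subset.
move=> /exists_inPn smallN.
have degS : red_degree_le c S D by move=> x /smallN; lia.
apply: (bounded_red_degree_embedding t_gt0 tm degS).
apply: leq_trans leS; rewrite /D expnS.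
have : 0 < t * t ^ k by rewrite -expnS expn_gt0 t_gt0.
nia.
Qed.

End CliqueFreeHosts.

Lemma blue_embedding_copy (N : nat) (c : coloring N) (G : sgraph)
    (S : {set 'I_N}) (f : G -> 'I_N) :
  blue_embedding c [set: G] S f -> mono_copy c false G.
Proof.
move=> [finj _ fblue]; apply/existsP; exists (finfun f); apply/andP; split.
  by apply/injectiveP => x y; rewrite !ffunE; apply: finj; rewrite inE.
apply/'forall_forallP => x y; apply/implyP => xy; rewrite !ffunE.
by rewrite fblue ?inE.
Qed.

Lemma no_red_copy_clique_free (N : nat) (c : coloring N) r :
  ~~ mono_copy c true (complete_graph r) -> red_clique_free c r [set: 'I_N].
Proof.
move=> noRed B _ Bred; apply: contraNneq noRed => cardB.
by apply: mono_clique_copy Bred; rewrite cardB card_ord.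
Qed.

Lemma ramsey_number_le (N : nat) (H G : sgraph) :
  0 < N -> arrows N H G -> ramsey_number H G <= N.
Proof.
move=> N_gt0 NHG; rewrite /ramsey_number; case: ex_minnP => n _; apply.
by rewrite N_gt0.
Qed.

Lemma ramsey_clique_le (G : sgraph) k t :
    0 < #|G| -> 0 < t -> 2 * #|edges G| <= t ^ 2 ->
  ramsey_number (complete_graph k.+3) G
    <= (k.+1 * #|G| + 2 * #|edges G|) * t ^ k.
Proof.
move=> G_gt0 t_gt0 tm; apply: ramsey_number_le.
  by rewrite muln_gt0 addn_gt0 muln_gt0 G_gt0 expn_gt0 t_gt0.
apply/forallP => c.
have [//|/no_red_copy_clique_free free] := boolP (mono_copy c true _).
have [|f] := clique_free_embedding G_gt0 t_gt0 tm _ free.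
  by rewrite cardsT card_ord.
exact: blue_embedding_copy.
Qed.

Lemma ramsey_clique_no_isolated_le (G : sgraph) k t :
    0 < #|G| -> no_isolated G -> 2 * #|edges G| <= t ^ 2 ->
  ramsey_number (complete_graph k.+3) G <= (2 * k + 4) * #|edges G| * t ^ k.
Proof.
move=> G_gt0 /no_isolated_card_leq n2m tm; have t_gt0 : 0 < t by nia.
apply: leq_trans (ramsey_clique_le k G_gt0 t_gt0 tm) _.
by rewrite leq_mul2r; apply/orP; right; nia.
Qed.

Lemma exists_sqrt_between n : exists t, n <= t ^ 2 <= 4 * n.
Proof.
have ex : exists t, n <= t ^ 2 by exists n; nia.
exists (ex_minn ex); case: ex_minnP => t nt /(_ t.-1) min; rewrite nt /=.
have : 0 < t -> t.-1 ^ 2 < n.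
  by move=> t_gt0; rewrite ltnNge; apply/negP => /min; lia.
nia.
Qed.

Local Open Scope ring_scope.

Lemma powR_half_nat (R : realType) (x : R) (n : nat) :
  0 <= x -> x `^ (n%:R / 2%:R) = Num.sqrt x ^+ n.
Proof.
by move=> x_ge0; rewrite mulrC powRrM powR12_sqrt // powR_mulrn ?sqrtr_ge0.
Qed.

Theorem theorem3 (R : realType) (r : nat) (hr : (3 <= r)%N) :
  exists c : R, forall (G : sgraph) (m : nat),
    (0 < #|G|)%N -> no_isolated G -> #|edges G| = m ->
    (ramsey_number (complete_graph r) G)%:R <= c * m%:R `^ ((r%:R - 1) / 2%:R).
Proof.
case: r hr => [|[|[|k]]] // _; exists ((2 * k + 4)%:R * Num.sqrt 8%:R ^+ k).
move=> G m G_gt0 noiso Em; have [t /andP[tm mt]] := exists_sqrt_between (2 * m).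
have t_le : t%:R <= Num.sqrt 8%:R * Num.sqrt m%:R :> R.
  rewrite -(ler_pXn2r (ltn0Sn 1)) ?nnegrE ?mulr_ge0 ?sqrtr_ge0 //.
  by rewrite exprMn !sqr_sqrtr // -natrX -natrM ler_nat; lia.
have -> : m%:R `^ ((k.+3%:R - 1) / 2%:R) = m%:R * Num.sqrt m%:R ^+ k :> R.
  rewrite -[k.+3%:R]natr1 addrK powR_half_nat //.
  by rewrite -addn2 exprD sqr_sqrtr // mulrC.
rewrite mulrACA -natrM -exprMn; rewrite -Em in tm.
have := ramsey_clique_no_isolated_le k G_gt0 noiso tm.
rewrite Em -(ler_nat R) natrM natrX => /le_trans; apply.
by rewrite ler_wpM2l // lerXn2r ?nnegrE ?mulr_ge0 ?sqrtr_ge0.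
Qed.
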